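(* The definite hyperbolic singularity and the indefinite singularity, together with their generic bifurcations, are realized by Helmholtz waves (for $k=1$, $c=1$). Namely: (1) $\Psi(x,y,z,t)=(-\cos x-\cos y+2\cos z+\mathrm{i}\sin z)\cos t+\cos z\,\sin t$ is a Helmholtz wave which realizes, at the origin and $t=0$, the definite hyperbolic singularity $x^2+y^2-z^2+\mathrm{i}z$ with its generic bifurcation $\mathrm{DH}_t$: $x^2+y^2-z^2+t+\mathrm{i}z$; (2) $\Psi(x,y,z,t)=(-2\cos x+\cos y+\cos z+\mathrm{i}\sin z)\cos t+\cos z\,\sin t$ is a Helmholtz wave which realizes, at the origin and $t=0$, the indefinite singularity $x^2-y^2-z^2+\mathrm{i}z$ with its generic bifurcation $\mathrm{I}_t$: $x^2-y^2-z^2+t+\mathrm{i}z$.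
   Context: $\mathbb{C}$ is identified with $\mathbb{R}^2$ via $u+\mathrm{i}w=(u,w)$. A Helmholtz wave for $k,c>0$ is a smooth complex valued function $\Psi(x,y,z,t)$ satisfying both $\Psi_{xx}+\Psi_{yy}+\Psi_{zz}+k^2\Psi=0$ and $\Psi_{tt}=c^2(\Psi_{xx}+\Psi_{yy}+\Psi_{zz})$. A radial transformation near $0\in\mathbb{C}$ is a local diffeomorphism $\tau:(\mathbb{C},0)\to(\mathbb{C},0)$, $\tau(u,w)=(U,W)$, sending each radial line (ray) $\{\theta=\mathrm{const.}\}$ to a radial line, where $u+\mathrm{i}w=re^{\mathrm{i}\theta}$; equivalently $U=\rho(u,w)(au+bw)$, $W=\rho(u,w)(cu+dw)$ with $\rho$ a positive function and $a,b,c,d\in\mathbb{R}$, $ad-bc\neq0$. $\Psi$ realizes a singularity $\psi=F(\cdot,\cdot,\cdot,0)$ with the bifurcation $F(x,y,z,t)$ at the origin and $t=0$ if the two family germs are radially equivalent as families: there are a local diffeomorphism $t\mapsto s(t)$ of $(\mathbb{R},0)$, a smooth family of local diffeomorphisms $\sigma_t$ of $\mathbb{R}^3$ (defined near the origin for $t$ near $0$, with $\sigma_0(0)=0$), and a smooth family of local radial transformations $\tau_t$ of $(\mathbb{C},0)$, such that $\Psi(\sigma_t(x,y,z),s(t))=\tau_t(F(x,y,z,t))$ for $(x,y,z,t)$ near the origin. *)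

(* Defs.v *)
From HB Require Import structures.
From mathcomp Require Import all_boot all_order all_algebra.
From mathcomp Require Import complex.
From mathcomp Require Import all_classical all_reals all_analysis.

Set Implicit Arguments.
Unset Strict Implicit.
Unset Printing Implicit Defensive.

Import Order.TTheory GRing.Theory Num.Theory.
Import numFieldNormedType.Exports.

Local Open Scope classical_set_scope.
Local Open Scope ring_scope.

Section SmoothMaps.
Context {R : realType} {V W : normedModType R}.

(* For finite-dimensional V (the only case used) this is the usual C^k: all
   iterated partial derivatives up to order k exist and are continuous.
   It is meant for open sets A. *)
Fixpoint Ck_on (k : nat) (A : set V) (f : V -> W) : Prop :=
  match k with
  | 0 => forall x, A x -> {for x, continuous f}
  | k'.+1 => (forall x, A x -> differentiable f x) /\
             (forall v : V, Ck_on k' A ('D_v f))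
  end.

Definition smooth_on (A : set V) (f : V -> W) : Prop :=
  forall k, Ck_on k A f.

End SmoothMaps.

Section Diffeomorphisms.
Context {R : realType} {V : normedModType R}.

Definition diffeo_on (A : set V) (f : V -> V) : Prop :=
  exists (B : set V) (g : V -> V),
    [/\ open A /\ open B,
        smooth_on A f /\ smooth_on B g,
        (forall x, A x -> B (f x)) /\ (forall y, B y -> A (g y)),
        (forall x, A x -> g (f x) = x) &
        (forall y, B y -> f (g y) = y)].

Definition local_diffeo_at (x : V) (f : V -> V) : Prop :=
  exists2 A : set V, A x & diffeo_on A f.

Definition smooth_family_on (J : set R) (A : set V) (f : R -> V -> V) : Prop :=
  [/\ open J, open A &
      smooth_on (A `*` J) (fun q : V * R => f q.2 q.1)].

Definition local_diffeo_family (f : R -> V -> V) : Prop :=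
  exists (J : set R) (A : set V),
    [/\ J 0, A 0, smooth_family_on J A f &
        forall t, J t -> diffeo_on A (f t)].

End Diffeomorphisms.

Section Waves.
Context {R : realType}.

(* C is identified with R^2: smoothness and derivatives of a complex-valued
   function f are those of toR2 \o f. *)
Definition toR2 (z : R[i]) : R * R := (complex.Re z, complex.Im z).

Definition ray (theta : R) : set (R * R) :=
  [set p | exists2 r : R, 0 < r & p = (r * cos theta, r * sin theta)].

(* The linear form rho * (a u + b w, c u + d w) follows, the derivative of tau
   at 0 being invertible. *)
Definition radial_on (A : set (R * R)) (tau : R * R -> R * R) : Prop :=
  [/\ diffeo_on A tau, tau 0 = 0 &
      forall theta, exists theta', tau @` (A `&` ray theta) `<=` ray theta'].

Definition local_radial_family (tau : R -> R * R -> R * R) : Prop :=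
  exists (J : set R) (A : set (R * R)),
    [/\ J 0, A 0, smooth_family_on J A tau &
        forall t, J t -> radial_on A (tau t)].

(* R * R * R * R is (R * R * R) * R, i.e. space x time. *)

Definition dx : R * R * R * R := (1, 0, 0, 0).
Definition dy : R * R * R * R := (0, 1, 0, 0).
Definition dz : R * R * R * R := (0, 0, 1, 0).
Definition dt : R * R * R * R := (0, 0, 0, 1).

Definition laplacian (f : R * R * R * R -> R * R) (p : R * R * R * R) : R * R :=
  'D_dx ('D_dx f) p + 'D_dy ('D_dy f) p + 'D_dz ('D_dz f) p.

Definition helmholtz_wave (k c : R) (Psi : R * R * R * R -> R[i]) : Prop :=
  let f : R * R * R * R -> R * R := toR2 \o Psi in
  [/\ 0 < k, 0 < c, smooth_on setT f,
      (forall p, laplacian f p + k ^+ 2 *: f p = 0) &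
      (forall p, 'D_dt ('D_dt f) p = c ^+ 2 *: laplacian f p)].

Definition radially_equivalent_families
    (Psi F : R * R * R * R -> R[i]) : Prop :=
  exists (s : R -> R) (sigma : R -> R * R * R -> R * R * R)
         (tau : R -> R * R -> R * R),
    [/\ local_diffeo_at 0 s /\ s 0 = 0,
        local_diffeo_family sigma /\ sigma 0 0 = 0,
        local_radial_family tau &
        \forall q \near ((0 : R * R * R), (0 : R)),
          toR2 (Psi (sigma q.2 q.1, s q.2)) = tau q.2 (toR2 (F q))].

Definition realizes (Psi : R * R * R * R -> R[i])
    (psi : R * R * R -> R[i]) (F : R * R * R * R -> R[i]) : Prop :=
  (\forall p \near (0 : R * R * R), psi p = F (p, 0)) /\
  radially_equivalent_families Psi F.

Local Open Scope complex_scope.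

Definition definite_hyperbolic (p : R * R * R) : R[i] :=
  let: (x, y, z) := p in (x ^+ 2 + y ^+ 2 - z ^+ 2)%:C + 'i * z%:C.

Definition DH (q : R * R * R * R) : R[i] :=
  let: (x, y, z, t) := q in (x ^+ 2 + y ^+ 2 - z ^+ 2 + t)%:C + 'i * z%:C.

Definition indefinite (p : R * R * R) : R[i] :=
  let: (x, y, z) := p in (x ^+ 2 - y ^+ 2 - z ^+ 2)%:C + 'i * z%:C.

Definition Ind (q : R * R * R * R) : R[i] :=
  let: (x, y, z, t) := q in (x ^+ 2 - y ^+ 2 - z ^+ 2 + t)%:C + 'i * z%:C.

Definition Psi_DH (q : R * R * R * R) : R[i] :=
  let: (x, y, z, t) := q in
  ((- cos x - cos y + 2 * cos z)%:C + 'i * (sin z)%:C) * (cos t)%:C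
  + (cos z * sin t)%:C.

Definition Psi_I (q : R * R * R * R) : R[i] :=
  let: (x, y, z, t) := q in
  ((- 2 * cos x + cos y + cos z)%:C + 'i * (sin z)%:C) * (cos t)%:C
  + (cos z * sin t)%:C.

End Waves.

(* Main.v *)
Require Import Defs.
From mathcomp Require Import all_boot all_order all_algebra.
From mathcomp Require Import complex ring lra.
From mathcomp Require Import all_classical all_reals all_analysis.

Set Implicit Arguments.
Unset Strict Implicit.
Unset Printing Implicit Defensive.

Import Order.TTheory GRing.Theory Num.Theory.
Import numFieldNormedType.Exports.

Local Open Scope classical_set_scope.
Local Open Scope ring_scope.

(** Both waves belong to the family
      [(- a cos x - e cos y + (a + e) cos z + i sin z) cos t + cos z sin t]
    with [(a, e) = (1, 1)] and [(2, -1)], and both bifurcations have the form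
      [X ^ 2 + e Y ^ 2 - Z ^ 2 + T + i Z].
    Every term of the wave is a product of sines and cosines of one space
    coordinate and of the time, so that its Laplacian and its second time
    derivative are both its opposite: this is the Helmholtz property
    ([helmholtz_wave_of]).

    The equivalence rests on conics. Write [m = a + e]. On the axis
    [x = y = 0] the values of the wave at time [t] form an arc of an ellipse,
    and on [X = Y = 0] the values of the bifurcation at time [T] form the
    parabola [U = T - W ^ 2]. A projective map of the plane that fixes the
    origin is, up to a factor that is positive near the origin, a linear map;
    it is therefore radial. One such map carries the parabola to the ellipse:
    with [tan t = 2 m T / (1 - T)] ([time_change]) it is ([tau])
      [(U, W) |-> 2 cos t / (1 + T - U) * (m U / (1 - T), W)].

    Once [t] and [tau] are fixed, the equation
      [wave (sigma_T (X, Y, Z), t) = tau_T (bifurcation (X, Y, Z, T))]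
    has two real components, which determine [tan (z / 2)] and
    [a sin ^ 2 (x / 2) + e sin ^ 2 (y / 2)] from [X ^ 2 + e Y ^ 2] and [Z]. With
    [D = 1 + Z ^ 2 - X ^ 2 - e Y ^ 2], the ratio [r = tan (z / 2) / Z] is the
    root of [Z ^ 2 r ^ 2 - D r + 1 = 0] that equals [1] at the origin, hence a
    smooth function ([stretch]); and
    [a sin ^ 2 (x / 2) + e sin ^ 2 (y / 2)] is [X ^ 2 + e Y ^ 2] times a smooth
    positive factor ([gain]), so that [sin (x / 2)] and [sin (y / 2)] may be
    taken proportional to [X] and [Y]. This is [sigma]; its inverse is equally
    explicit in the half angles, so no inverse function theorem is used
    ([diffeo_of_inverse]). The equation itself is [wave_sigma].

    All maps being given by formulas, smoothness reduces to the stability of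
    smooth functions under arithmetic, square roots, trigonometric functions
    and their inverses. *)

(** * Smooth functions *)

Section Calculus.
Context {R : realType}.
Implicit Types V W : normedModType R.

Lemma derive_pair V W1 W2 (f : V -> W1) (g : V -> W2) x v :
  differentiable f x -> differentiable g x ->
  'D_v (fun y => (f y, g y)) x = ('D_v f x, 'D_v g x).
Proof.
move=> df dg; rewrite !deriveE//; last exact: differentiable_pair.
by rewrite diff_pair.
Qed.

Lemma differentiable_fst V W1 W2 (f : V -> W1 * W2) x :
  differentiable f x -> differentiable (fun y => (f y).1) x.
Proof.
move=> df; apply: (@differentiable_comp _ _ _ _ f fst) => //.
by apply: linear_differentiable => y; exact: cvg_fst.
Qed.

Lemma differentiable_snd V W1 W2 (f : V -> W1 * W2) x :
  differentiable f x -> differentiable (fun y => (f y).2) x.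
Proof.
move=> df; apply: (@differentiable_comp _ _ _ _ f snd) => //.
by apply: linear_differentiable => y; exact: cvg_snd.
Qed.

Lemma derive_proj V W1 W2 (f : V -> W1 * W2) x v : differentiable f x ->
  'D_v f x = ('D_v (fun y => (f y).1) x, 'D_v (fun y => (f y).2) x).
Proof.
move=> df; rewrite -derive_pair.
- by congr ('D_v _ x); apply/funext => y; case: (f y).
- exact: differentiable_fst.
- exact: differentiable_snd.
Qed.

Lemma derive_comp V (phi : R -> R) (f : V -> R) x v :
  differentiable f x -> differentiable phi (f x) ->
  'D_v (phi \o f) x = 'D_1 phi (f x) * 'D_v f x.
Proof.
move=> df dphi; rewrite !deriveE//; last exact: differentiable_comp.
rewrite diff_comp//= -[in LHS](mulr1 ('d f x v)) -[_ * 1]/(_ *: 1).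
by rewrite linearZ/= mulrC.
Qed.

Lemma derive_scalar (phi : R -> R) (x v : R) : differentiable phi x ->
  'D_v phi x = v * 'D_1 phi x.
Proof.
move=> dphi; rewrite !deriveE// -[in LHS](mulr1 v) -[v * 1]/(v *: 1).
by rewrite linearZ.
Qed.

(** Differentiability is local: the difference of the two functions vanishes
    near the point, hence it is negligible there. *)
Lemma near_eq_differentiable V W (f g : V -> W) x :
  {near x, f =1 g} -> differentiable f x -> differentiable g x.
Proof.
move=> fg df; pose h := g - f.
have hx0 : h x = 0 by rewrite -[LHS]/(g x - f x) (nbhs_singleton fg) subrr.
have ho : h \o shift x = cst (h x) + (\0 : V -> W) +o_ 0 id.
  apply/eqaddoP => _/posnumP[e]; have := fg; rewrite (near_shift 0) subr0 => {}fg.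
  near=> y; rewrite -[X in `|X|]/(g (y + x) - f (y + x) - (h x + 0)) hx0.
  have -> : g (y + x) = f (y + x) by apply/esym; near: y.
  by rewrite subrr addr0 subr0 normr0 mulr_ge0.
have c0 : continuous (\0 : V -> W) by exact: cst_continuous.
have -> : g = f + h by rewrite /h addrC subrK.
apply: differentiableD => //; apply/diff_locallyP.
by rewrite (diff_unique c0 ho).
Unshelve. all: by end_near. Qed.

(** The derivatives of a map are known only on [A]; this is what allows a
    formula valid on [A] to replace them in the inductions below. *)
Lemma Ck_ext V W k (A : set V) (f g : V -> W) : open A ->
  (forall x, A x -> f x = g x) -> Ck_on k A f -> Ck_on k A g.
Proof.
move=> oA; have nA x : A x -> \near x, A x by move=> Ax; exact: open_nbhs_nbhs.
elim: k f g => [|k IH] f g fg.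
  move=> cf x Ax; rewrite /prop_for /continuous_at -fg//.
  apply: cvg_trans (cf x Ax); apply: near_eq_cvg.
  by near=> y; apply: fg; near: y; exact: nA.
move=> [df Df]; split=> [x Ax|v].
  by apply: near_eq_differentiable (df x Ax); near=> y; apply: fg; near: y; exact: nA.
apply: IH (Df v) => x Ax.
by apply: near_eq_derive; near=> y; apply: fg; near: y; exact: nA.
Unshelve. all: by end_near. Qed.


Lemma Ck_pred V W k (A : set V) (f : V -> W) : Ck_on k.+1 A f -> Ck_on k A f.
Proof.
elim: k f => [|k IH] f [df Df].
  by move=> x Ax; exact: differentiable_continuous (df x Ax).
by split=> // v; apply: IH; exact: Df.
Qed.

Lemma Ck_cst V W k (A : set V) (c : W) : Ck_on k A (fun _ : V => c).
Proof.
elim: k c => [|k IH] c; first by move=> x _; exact: cst_continuous.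
split=> [x _|v]; first exact: differentiable_cst.
by rewrite (_ : 'D_v _ = fun=> 0); [exact: IH|apply/funext => x; exact: derive_cst].
Qed.

Lemma Ck_id V k (A : set V) : Ck_on k A (fun x : V => x).
Proof.
case: k => [|k]; first by move=> x _; exact: cvg_id.
split=> [x _|v]; first exact: ex_diff.
by rewrite (_ : 'D_v _ = fun=> v); [exact: Ck_cst|apply/funext => x; exact: derive_id].
Qed.

Lemma Ck_pair V W1 W2 k (A : set V) (f : V -> W1) (g : V -> W2) : open A ->
  Ck_on k A f -> Ck_on k A g -> Ck_on k A (fun x => (f x, g x)).
Proof.
move=> oA; elim: k f g => [|k IH] f g.
  by move=> cf cg x Ax; apply: cvg_pair; [exact: cf|exact: cg].
move=> [df Df] [dg Dg]; split=> [x Ax|v].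
  by apply: differentiable_pair; [exact: df|exact: dg].
apply: (Ck_ext (f := fun x => ('D_v f x, 'D_v g x))) => // [x Ax|].
  by rewrite derive_pair//; [exact: df|exact: dg].
by apply: IH; [exact: Df|exact: Dg].
Qed.

Lemma Ck_fst V W1 W2 k (A : set V) (f : V -> W1 * W2) : open A ->
  Ck_on k A f -> Ck_on k A (fun x => (f x).1).
Proof.
move=> oA; elim: k f => [|k IH] f.
  move=> cf x Ax; apply: (@continuous_comp _ _ _ f fst); first exact: cf.
  exact: cvg_fst.
move=> [df Df]; split=> [x Ax|v]; first by apply: differentiable_fst; exact: df.
apply: (Ck_ext (f := fun x => ('D_v f x).1)) => // [x Ax|]; last by apply: IH; exact: Df.
by rewrite derive_proj//; exact: df.
Qed.

Lemma Ck_snd V W1 W2 k (A : set V) (f : V -> W1 * W2) : open A ->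
  Ck_on k A f -> Ck_on k A (fun x => (f x).2).
Proof.
move=> oA; elim: k f => [|k IH] f.
  move=> cf x Ax; apply: (@continuous_comp _ _ _ f snd); first exact: cf.
  exact: cvg_snd.
move=> [df Df]; split=> [x Ax|v]; first by apply: differentiable_snd; exact: df.
apply: (Ck_ext (f := fun x => ('D_v f x).2)) => // [x Ax|]; last by apply: IH; exact: Df.
by rewrite derive_proj//; exact: df.
Qed.

Lemma CkD V W k (A : set V) (f g : V -> W) : open A ->
  Ck_on k A f -> Ck_on k A g -> Ck_on k A (fun x => f x + g x).
Proof.
move=> oA; elim: k f g => [|k IH] f g.
  by move=> cf cg x Ax; apply: cvgD; [exact: cf|exact: cg].
move=> [df Df] [dg Dg]; split=> [x Ax|v].
  by apply: differentiableD; [exact: df|exact: dg].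
apply: (Ck_ext (f := fun x => 'D_v f x + 'D_v g x)) => // [x Ax|].
  by rewrite -deriveD//; apply: diff_derivable; [exact: df|exact: dg].
by apply: IH; [exact: Df|exact: Dg].
Qed.

Lemma CkM V k (A : set V) (f g : V -> R) : open A ->
  Ck_on k A f -> Ck_on k A g -> Ck_on k A (fun x => f x * g x).
Proof.
move=> oA; elim: k f g => [|k IH] f g.
  by move=> cf cg x Ax; apply: cvgM; [exact: cf|exact: cg].
move=> Cf Cg; have [df Df] := Cf; have [dg Dg] := Cg; split=> [x Ax|v].
  by apply: differentiableM; [exact: df|exact: dg].
apply: (Ck_ext (f := fun x => f x * 'D_v g x + g x * 'D_v f x)) => // [x Ax|].
  by rewrite -[LHS]deriveM//; apply: diff_derivable; [exact: df|exact: dg].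
by apply: CkD => //; apply: IH; [exact: Ck_pred|exact: Dg|exact: Ck_pred|exact: Df].
Qed.

Lemma Ck_comp V k (I : set R) (A : set V) (phi : R -> R) (f : V -> R) :
  open A -> (forall x, A x -> I (f x)) ->
  Ck_on k I phi -> Ck_on k A f -> Ck_on k A (fun x => phi (f x)).
Proof.
move=> oA fI; elim: k phi f fI => [|k IH] phi f fI.
  move=> cphi cf x Ax; apply: (@continuous_comp _ _ _ f phi); first exact: cf.
  exact/cphi/fI.
move=> [dphi Dphi] Cf; have [df Df] := Cf; split=> [x Ax|v].
  by apply: (@differentiable_comp _ _ _ _ f phi); [exact: df|exact/dphi/fI].
apply: (Ck_ext (f := fun x => 'D_1 phi (f x) * 'D_v f x)) => // [x Ax|].
  by rewrite -derive_comp//; [exact: df|exact/dphi/fI].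
apply: CkM => //; last exact: Df.
exact: (IH ('D_1 phi) f fI (Dphi 1) (Ck_pred Cf)).
Qed.

Lemma Ck_is_derive k (I : set R) (phi psi : R -> R) : open I ->
  (forall x, I x -> is_derive x 1 phi (psi x)) ->
  Ck_on k I psi -> Ck_on k.+1 I phi.
Proof.
move=> oI dphi Cpsi.
have dI x : I x -> differentiable phi x.
  by move=> Ix; apply/derivable1_diffP; case: (dphi x Ix).
split=> // v; apply: (Ck_ext (f := fun x => v * psi x)) => // [x Ix|].
  by rewrite derive_scalar; [case: (dphi x Ix) => _ ->|exact: dI].
by apply: CkM => //; exact: Ck_cst.
Qed.

(** Bootstrap: a solution of an autonomous equation [phi' = G phi] gains one
    order of smoothness at each step. Inverse, square root and arcsine are all
    obtained in this way, without computing their higher derivatives. *)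
Lemma smooth_ode (I B : set R) (phi G : R -> R) : open I ->
  (forall x, I x -> B (phi x)) -> smooth_on B G ->
  (forall x, I x -> is_derive x 1 phi (G (phi x))) -> smooth_on I phi.
Proof.
move=> oI IB sG dphi; elim=> [x Ix|k IH].
  apply/differentiable_continuous/derivable1_diffP.
  exact: (@ex_derive _ _ _ _ _ _ _ (dphi x Ix)).
apply: Ck_is_derive dphi _ => //; exact: Ck_comp (sG k) IH.
Qed.

Section SmoothOn.
Context {V : normedModType R} (A : set V) (oA : open A).

Lemma smooth_ext W (f g : V -> W) :
  (forall x, A x -> f x = g x) -> smooth_on A f -> smooth_on A g.
Proof. by move=> fg sf k; exact: Ck_ext (sf k). Qed.

Lemma smooth_cst W (c : W) : smooth_on A (fun=> c).
Proof. by move=> k; exact: Ck_cst. Qed.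

Lemma smooth_id : smooth_on A (fun x => x).
Proof. by move=> k; exact: Ck_id. Qed.

Lemma smooth_pair W1 W2 (f : V -> W1) (g : V -> W2) :
  smooth_on A f -> smooth_on A g -> smooth_on A (fun x => (f x, g x)).
Proof. by move=> sf sg k; exact: Ck_pair. Qed.

Lemma smooth_fst W1 W2 (f : V -> W1 * W2) :
  smooth_on A f -> smooth_on A (fun x => (f x).1).
Proof. by move=> sf k; exact: Ck_fst. Qed.

Lemma smooth_snd W1 W2 (f : V -> W1 * W2) :
  smooth_on A f -> smooth_on A (fun x => (f x).2).
Proof. by move=> sf k; exact: Ck_snd. Qed.

Lemma smoothD W (f g : V -> W) :
  smooth_on A f -> smooth_on A g -> smooth_on A (fun x => f x + g x).
Proof. by move=> sf sg k; exact: CkD. Qed.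

Lemma smoothM (f g : V -> R) :
  smooth_on A f -> smooth_on A g -> smooth_on A (fun x => f x * g x).
Proof. by move=> sf sg k; exact: CkM. Qed.

Lemma smoothN (f : V -> R) : smooth_on A f -> smooth_on A (fun x => - f x).
Proof.
move=> sf; apply: (smooth_ext (f := fun x => -1 * f x)) => [x _|].
  by rewrite mulN1r.
by apply: smoothM => //; exact: smooth_cst.
Qed.

Lemma smoothX (f : V -> R) n : smooth_on A f -> smooth_on A (fun x => f x ^+ n).
Proof.
move=> sf; elim: n => [|n IH]; first exact: smooth_cst.
apply: (smooth_ext (f := fun x => f x * f x ^+ n)) => [x _|].
  by rewrite exprS.
exact: smoothM.
Qed.

Lemma smooth_comp (I : set R) (phi : R -> R) (f : V -> R) :
  (forall x, A x -> I (f x)) -> smooth_on I phi -> smooth_on A f ->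
  smooth_on A (fun x => phi (f x)).
Proof. by move=> fI sphi sf k; exact: Ck_comp (sphi k) (sf k). Qed.

Lemma smooth_continuous W (f : V -> W) x :
  smooth_on A f -> A x -> {for x, continuous f}.
Proof. by move=> sf; exact: (sf 0%N). Qed.

End SmoothOn.


Lemma smooth_inv : smooth_on [set x : R | x != 0] (fun x => x^-1).
Proof.
have oI := @open_neq R 0.
apply: (@smooth_ode _ setT _ (fun y => - y ^+ 2)) => // [|x /= x0].
  have oT := @openT R; apply: smoothN => //; apply: smoothX => //.
  exact: smooth_id.
have xid : derivable (fun y : R => y) x 1 by exact: derivable_id.
apply: DeriveDef; first exact: (@derivableV _ _ (fun y : R => y)).
rewrite (@deriveV _ _ (fun y : R => y))// derive_id -exprVn.
by rewrite /GRing.scale /= mulr1.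
Qed.

Lemma smooth_sqrt_pos : smooth_on [set x : R | 0 < x] (@Num.sqrt R).
Proof.
have oI : open [set x : R | 0 < x] by exact: open_gt.
apply: (@smooth_ode _ [set x : R | x != 0] _ (fun y => (2 * y)^-1)) => //.
- by move=> x /= x0; rewrite gt_eqF// sqrtr_gt0.
- apply: (smooth_comp (@open_neq R 0) _ smooth_inv) => [x /= x0|].
    by rewrite mulf_neq0.
  by apply: (smoothM (@open_neq R 0)); [exact: smooth_cst|exact: smooth_id].
Qed.

Lemma smooth_sin_cos : smooth_on setT (@sin R) /\ smooth_on setT (@cos R).
Proof.
have CI k : Ck_on k setT (@sin R) /\ Ck_on k setT (@cos R).
  elim: k => [|k [IHs IHc]].
    by split=> x _; [exact: continuous_sin|exact: continuous_cos].
  split; first by apply: Ck_is_derive IHc => //; exact: openT.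
  apply: (Ck_is_derive (psi := fun x => - sin x)) => //; first exact: openT.
  - apply: (Ck_ext (f := fun x => -1 * sin x)) => [|x _|]; first exact: openT.
      by rewrite mulN1r.
    by apply: CkM => //; [exact: openT|exact: Ck_cst].
by split=> k; have [] := CI k.
Qed.

Lemma open_between (a b : R) : open [set x | a < x < b].
Proof.
have -> : [set x | a < x < b] = [set` `]a, b[%R].
  by apply/seteqP; split=> x /=; rewrite in_itv.
exact: interval_open.
Qed.

Lemma smooth_asin_itv : smooth_on [set x : R | -1 < x < 1] (@asin R).
Proof.
have oB : open [set y : R | cos y != 0].
  have -> : [set y : R | cos y != 0] = @cos R @^-1` [set x | x != 0] by [].
  by apply: open_comp (@open_neq R 0) => x _; exact: continuous_cos.
apply: (@smooth_ode _ [set y : R | cos y != 0] _ (fun y => (cos y)^-1)).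
- exact: open_between.
- move=> x /= /andP[x0 x1]; rewrite cos_asin; last by rewrite !ltW.
  rewrite gt_eqF// sqrtr_gt0 subr_gt0 -ltr_sqrt// sqrtr1 sqrtr_sqr.
  by rewrite ltr_norml x0.
- apply: (smooth_comp oB _ smooth_inv) => //.
  apply: (smooth_comp oB (I := setT)) => //; first by have [] := smooth_sin_cos.
  exact: smooth_id.
- move=> x /= x1; rewrite cos_asin; last by case/andP: x1 => *; rewrite !ltW.
  exact: is_derive1_asin.
Qed.

Section Compositions.
Context {V : normedModType R} (A : set V) (oA : open A).
Implicit Types f : V -> R.

Lemma smoothV f : (forall x, A x -> f x != 0) -> smooth_on A f ->
  smooth_on A (fun x => (f x)^-1).
Proof. by move=> f0; exact: smooth_comp smooth_inv. Qed.

Lemma smooth_sqrt f : (forall x, A x -> 0 < f x) -> smooth_on A f ->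
  smooth_on A (fun x => Num.sqrt (f x)).
Proof. by move=> f0; exact: smooth_comp smooth_sqrt_pos. Qed.

Lemma smooth_sin f : smooth_on A f -> smooth_on A (fun x => sin (f x)).
Proof. by apply: (smooth_comp oA (I := setT)) => //; case: smooth_sin_cos. Qed.

Lemma smooth_cos f : smooth_on A f -> smooth_on A (fun x => cos (f x)).
Proof. by apply: (smooth_comp oA (I := setT)) => //; case: smooth_sin_cos. Qed.

Lemma smooth_asin f : (forall x, A x -> -1 < f x < 1) -> smooth_on A f ->
  smooth_on A (fun x => asin (f x)).
Proof. by move=> f1; exact: smooth_comp smooth_asin_itv. Qed.

Lemma smooth_tan f : (forall x, A x -> cos (f x) != 0) -> smooth_on A f ->
  smooth_on A (fun x => tan (f x)).
Proof.
move=> f0 sf; apply: smoothM => //; first exact: smooth_sin.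
by apply: smoothV => //; exact: smooth_cos.
Qed.

End Compositions.

Lemma smooth_atan V (A : set V) (f : V -> R) : open A ->
  smooth_on A f -> smooth_on A (fun x => atan (f x)).
Proof.
move=> oA; apply: (smooth_comp oA (I := setT)) => // -[|k].
  by move=> x _; exact: continuous_atan.
have oT := @openT R.
apply: (Ck_is_derive (psi := fun x => (1 + x ^+ 2)^-1)) => //.
move: k; apply: smoothV => // [x _|]; first by rewrite gt_eqF// ltr_pwDl// sqr_ge0.
by apply: smoothD; [|exact: smooth_cst|apply: smoothX => //; exact: smooth_id].
Qed.

Lemma open_setI_preimage V W (A : set V) (B : set W) (f : V -> W) :
  open A -> open B -> (forall x, A x -> {for x, continuous f}) ->
  open (A `&` f @^-1` B).
Proof.
move=> oA oB cf; rewrite openE => x [Ax Bfx]; apply: filterI.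
  exact: open_nbhs_nbhs.
by apply: (cf x Ax); exact: open_nbhs_nbhs.
Qed.

Lemma open_setX V W (A : set V) (B : set W) :
  open A -> open B -> open (A `*` B).
Proof.
move=> oA oB; rewrite (_ : _ `*` _ = fst @^-1` A `&` snd @^-1` B)//.
by apply: openI; apply: open_comp => // q _; [exact: cvg_fst|exact: cvg_snd].
Qed.

Lemma open_lt_smooth V (A : set V) (f g : V -> R) : open A ->
  smooth_on A f -> smooth_on A g -> open [set x | A x /\ f x < g x].
Proof.
move=> oA sf sg.
have -> : [set x | A x /\ f x < g x] =
    A `&` (fun x => g x + - f x) @^-1` [set y | 0 < y].
  by apply/seteqP; split=> x /= [Ax]; rewrite subr_gt0.
apply: open_setI_preimage => // x.
by apply: smooth_continuous; apply: smoothD => //; exact: smoothN.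
Qed.

Lemma open_lt_smoothT V (f g : V -> R) :
  smooth_on setT f -> smooth_on setT g -> open [set x | f x < g x].
Proof.
move=> sf sg; rewrite (_ : mkset _ = [set x | setT x /\ f x < g x]).
  by apply: open_lt_smooth => //; exact: openT.
by apply/seteqP; split=> x //= [].
Qed.

Lemma smooth_subset V W (A B : set V) (f : V -> W) :
  B `<=` A -> smooth_on A f -> smooth_on B f.
Proof.
move=> BA sf k; elim: k f {sf}(sf k) => [|k IH] f /=.
  by move=> cf x /BA; exact: cf.
by move=> [df Df]; split=> [x /BA|v]; [exact: df|exact/IH/Df].
Qed.

(** The directional derivatives of a slice are those of the whole map along the
    directions [(v, 0)]. *)
Lemma Ck_slice V W (U : normedModType R) k (A : set V) (B : set U)
    (f : V * U -> W) u : B u -> Ck_on k (A `*` B) f -> Ck_on k A (fun x => f (x, u)).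
Proof.
move=> Bu; elim: k f => [|k IH] f /=.
  move=> cf x Ax; apply: (@continuous_comp _ _ _ (fun y => (y, u)) f);
    last exact: (cf (x, u) (conj Ax Bu)).
  by apply: cvg_pair; [exact: cvg_id|exact: cvg_cst].
move=> [df Df]; split=> [x Ax|v].
  apply: (@differentiable_comp _ _ _ _ (fun y => (y, u)) f);
    last exact: (df (x, u) (conj Ax Bu)).
  by apply: differentiable_pair => //; exact: differentiable_cst.
have -> : 'D_v (fun x => f (x, u)) = fun x => 'D_(v, 0) f (x, u).
  apply/funext => x; rewrite /derive.
  apply: (congr1 (fun g : R -> W => lim (g @ 0^'))).
  apply/funext => h /=; congr (_ *: (f _ - _)).
  by congr pair; rewrite /= scaler0 add0r.
exact: (IH _ (Df (v, 0))).
Qed.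

(** The inverse is allowed to be defined on a set [D] larger than the image of
    [A]: restricted to [D `&` g @^-1` A], which is open by continuity, it is
    exactly an inverse of [f] on [A], and the image need not be computed. *)
Lemma diffeo_of_inverse V (A D : set V) (f g : V -> V) :
  open A -> open D -> smooth_on A f -> smooth_on D g ->
  (forall x, A x -> D (f x)) -> (forall x, A x -> g (f x) = x) ->
  (forall y, D y -> f (g y) = y) -> diffeo_on A f.
Proof.
move=> oA oD sf sg AD gf fg; exists (D `&` g @^-1` A), g; split.
- split=> //; apply: open_setI_preimage => // x; exact: smooth_continuous.
- by split=> //; apply: smooth_subset sg; exact: subIsetl.
- by split=> [x Ax|y []//]; split; [exact: AD|rewrite /= gf].
- exact: gf.
- by move=> y [Dy _]; exact: fg.
Qed.

End Calculus.

(** Reduces the smoothness of an explicit formula to the side conditions of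
    its inverses, square roots, tangents and arcsines. *)
Ltac smooth := repeat first
  [ assumption | exact: openT
  | exact: smooth_cst | exact: smooth_id
  | apply: smooth_pair | apply: smoothD | apply: smoothN | apply: smoothM
  | apply: smoothX | apply: smoothV | apply: smooth_sqrt
  | apply: smooth_cos | apply: smooth_sin | apply: smooth_asin
  | apply: smooth_tan | apply: smooth_atan
  | apply: smooth_fst | apply: smooth_snd ].

(** * The Helmholtz equations *)

Section Waves.
Context {R : realType}.
Implicit Types (a e : R) (V W : normedModType R).

Definition wave a e (q : R * R * R * R) : R * R :=
  ((- (a * cos q.1.1.1) - e * cos q.1.1.2 + (a + e) * cos q.1.2) * cos q.2
     + cos q.1.2 * sin q.2,
   sin q.1.2 * cos q.2).

Definition unfolding e (q : R * R * R * R) : R * R :=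
  (q.1.1.1 ^+ 2 + e * q.1.1.2 ^+ 2 - q.1.2 ^+ 2 + q.2, q.1.2).

Lemma Psi_DHE : toR2 \o @Psi_DH R = wave 1 1.
Proof.
apply/funext => -[[[x y] z] t] /=; rewrite /toR2 /wave /=.
by congr pair; ring.
Qed.

Lemma Psi_IE : toR2 \o @Psi_I R = wave 2 (-1).
Proof.
apply/funext => -[[[x y] z] t] /=; rewrite /toR2 /wave /=.
by congr pair; ring.
Qed.

Lemma DHE (q : R * R * R * R) : toR2 (DH q) = unfolding 1 q.
Proof.
case: q => [[[x y] z] t]; rewrite /toR2 /unfolding /=.
by congr pair; ring.
Qed.

Lemma IndE (q : R * R * R * R) : toR2 (Ind q) = unfolding (-1) q.
Proof.
case: q => [[[x y] z] t]; rewrite /toR2 /unfolding /=.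
by congr pair; ring.
Qed.

Lemma smooth_wave a e : smooth_on setT (wave a e).
Proof. by rewrite /wave; smooth. Qed.

Section DirectionalDerivatives.
Context {V : normedModType R}.
Implicit Types (f g : V -> R) (p v : V).

(* Explicit bound variables make these rules match the formulas of the wave
   syntactically. *)
Lemma is_derive_add f g p v df dg : is_derive p v f df -> is_derive p v g dg ->
  is_derive p v (fun q => f q + g q) (df + dg).
Proof. exact: is_deriveD. Qed.

Lemma is_derive_opp f p v df : is_derive p v f df ->
  is_derive p v (fun q => - f q) (- df).
Proof. exact: is_deriveN. Qed.

Lemma is_derive_mul f g p v df dg : is_derive p v f df -> is_derive p v g dg ->
  is_derive p v (fun q => f q * g q) (f p * dg + g p * df).
Proof. exact: is_deriveM. Qed.

Lemma is_derive_comp1 (phi : R -> R) f p v l df : is_derive (f p) 1 phi l ->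
  differentiable f p -> 'D_v f p = df ->
  is_derive p v (fun q => phi (f q)) (l * df).
Proof.
move=> dphi dfp <-.
have Dphi : differentiable phi (f p).
  by apply/derivable1_diffP; case: dphi.
apply: DeriveDef.
  by apply: diff_derivable; exact: (@differentiable_comp _ _ _ _ f phi).
by rewrite (derive_comp _ dfp Dphi) (@derive_val _ _ _ _ _ _ _ dphi).
Qed.

End DirectionalDerivatives.

Lemma derive_fst V (W1 W2 : normedModType R) (f : V -> W1 * W2) x v :
  differentiable f x ->
  'D_v (fun y => (f y).1) x = ('D_v f x).1.
Proof. by move=> df; rewrite (derive_proj _ df). Qed.

Lemma derive_snd V (W1 W2 : normedModType R) (f : V -> W1 * W2) x v :
  differentiable f x ->
  'D_v (fun y => (f y).2) x = ('D_v f x).2.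
Proof. by move=> df; rewrite (derive_proj _ df). Qed.

Lemma smooth_derive_pair V (W1 W2 : normedModType R)
    (f : V -> W1) (g : V -> W2) v y :
  smooth_on setT f -> smooth_on setT g ->
  'D_v (fun x => (f x, g x)) y = ('D_v f y, 'D_v g y).
Proof.
by move=> /(_ 1%N)[df _] /(_ 1%N)[dg _]; apply: derive_pair; [exact: df|exact: dg].
Qed.

Let spacetime := (R * R * R * R)%type.

Lemma diff_coords (q v : spacetime) :
  [/\ differentiable (fun q : spacetime => q.1.1.1) q /\
        'D_v (fun q : spacetime => q.1.1.1) q = v.1.1.1,
      differentiable (fun q : spacetime => q.1.1.2) q /\
        'D_v (fun q : spacetime => q.1.1.2) q = v.1.1.2,
      differentiable (fun q : spacetime => q.1.2) q /\
        'D_v (fun q : spacetime => q.1.2) q = v.1.2 &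
      differentiable (fun q : spacetime => q.2) q /\
        'D_v (fun q : spacetime => q.2) q = v.2].
Proof.
have d0 : differentiable (fun q : spacetime => q) q by exact: ex_diff.
have d1 := differentiable_fst d0; have d2 := differentiable_fst d1.
split; split; [exact: (differentiable_fst d2)| | exact: (differentiable_snd d2) | |
  exact: (differentiable_snd d1) | | exact: (differentiable_snd d0) | ].
- by rewrite (derive_fst _ d2) (derive_fst _ d1) (derive_fst _ d0) derive_id.
- by rewrite (derive_snd _ d2) (derive_fst _ d1) (derive_fst _ d0) derive_id.
- by rewrite (derive_snd _ d1) (derive_fst _ d0) derive_id.
- by rewrite (derive_snd _ d0) derive_id.
Qed.

Lemma is_derive_coord_trig (c : spacetime -> R) dc (q v : spacetime) :
  differentiable c q /\ 'D_v c q = dc ->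
  is_derive q v (fun q => cos (c q)) (- sin (c q) * dc) /\
  is_derive q v (fun q => sin (c q)) (cos (c q) * dc).
Proof.
by move=> [dcq Dc]; split; apply: is_derive_comp1.
Qed.

(** Differentiates a polynomial in the sines and cosines of the coordinates at
    [q] in the direction [v]. *)
Ltac trig_derive q v :=
  have [/is_derive_coord_trig[? ?] /is_derive_coord_trig[? ?]
        /is_derive_coord_trig[? ?] /is_derive_coord_trig[? ?]] := diff_coords q v;
  eapply is_derive_eq;
  [ repeat first [ eassumption | apply: is_derive_add | apply: is_derive_opp
                 | apply: is_derive_mul | apply: is_derive_cst ]
  | rewrite /GRing.scale /=; ring ].

Definition dwave a e (v q : spacetime) : R * R :=
  ((a * v.1.1.1 * sin q.1.1.1 + e * v.1.1.2 * sin q.1.1.2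
    - (a + e) * v.1.2 * sin q.1.2) * cos q.2
   - (- (a * cos q.1.1.1) - e * cos q.1.1.2 + (a + e) * cos q.1.2) * v.2 * sin q.2
   - v.1.2 * sin q.1.2 * sin q.2 + v.2 * cos q.1.2 * cos q.2,
   v.1.2 * cos q.1.2 * cos q.2 - v.2 * sin q.1.2 * sin q.2).

Lemma derive_wave a e v : 'D_v (wave a e) = dwave a e v.
Proof.
apply/funext => q; rewrite smooth_derive_pair; try by smooth.
congr pair; apply: derive_val.
- by trig_derive q v.
- by trig_derive q v.
Qed.

Definition d2wave a e (v q : spacetime) : R * R :=
  ((a * v.1.1.1 ^+ 2 * cos q.1.1.1 + e * v.1.1.2 ^+ 2 * cos q.1.1.2
    - (a + e) * v.1.2 ^+ 2 * cos q.1.2) * cos q.2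
   - (a * v.1.1.1 * sin q.1.1.1 + e * v.1.1.2 * sin q.1.1.2
      - (a + e) * v.1.2 * sin q.1.2) * v.2 * sin q.2 *+ 2
   - (- (a * cos q.1.1.1) - e * cos q.1.1.2 + (a + e) * cos q.1.2)
     * v.2 ^+ 2 * cos q.2
   - (v.1.2 ^+ 2 + v.2 ^+ 2) * cos q.1.2 * sin q.2
   - v.1.2 * v.2 * sin q.1.2 * cos q.2 *+ 2,
   - (v.1.2 ^+ 2 + v.2 ^+ 2) * sin q.1.2 * cos q.2
   - v.1.2 * v.2 * cos q.1.2 * sin q.2 *+ 2).

Lemma derive2_wave a e v q : 'D_v ('D_v (wave a e)) q = d2wave a e v q.
Proof.
rewrite derive_wave smooth_derive_pair; try by smooth.
congr pair; apply: derive_val.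
- by trig_derive q v.
- by trig_derive q v.
Qed.

(** Each term of the wave is an eigenfunction, for the eigenvalue [-1], of both
    the Laplacian and the second time derivative. *)
Lemma helmholtz_wave_of a e Psi : toR2 \o Psi = wave a e ->
  helmholtz_wave 1 1 Psi.
Proof.
move=> PsiE; rewrite /helmholtz_wave PsiE.
have lapl q : laplacian (wave a e) q = - wave a e q.
  transitivity (d2wave a e dx q + d2wave a e dy q + d2wave a e dz q).
    by rewrite /laplacian; congr (_ + _ + _); exact: derive2_wave.
  by rewrite /d2wave /wave /=; congr pair => /=; ring.
split=> // [|q|q]; first exact: smooth_wave.
- by rewrite lapl expr1n scale1r addNr.
- rewrite lapl expr1n scale1r; apply: etrans; first exact: derive2_wave.
  by rewrite /d2wave /wave /=; congr pair => /=; ring.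
Qed.

End Waves.

(** * The time change *)

Section Equivalence.
Context {R : realType} (a e : R).
Hypothesis a0 : 0 < a.
Hypothesis m0 : 0 < a + e.
Let m := a + e.

(** Bounding [T] away from [1] and [-1] keeps [(1 + T) / (1 - T)] below [3],
    which allows [sigma_dom] below to be the same for all times. *)
Definition time_dom : set R := [set T | - 2^-1 < T < 2^-1].

Lemma m2_neq0 : 2 * m != 0.
Proof. by rewrite mulf_neq0// lt0r_neq0. Qed.

Lemma open_time_dom : open time_dom.
Proof. exact: open_between. Qed.

(** For this value of [t] the map [tau] below sends the parabola of the
    bifurcation at time [T] to the ellipse of the wave at time [t]. *)
Definition time_change (T : R) : R := atan (2 * m * T / (1 - T)).

Definition time_change_inv (t : R) : R := tan t / (2 * m + tan t).

Lemma time_dom_bounds T : time_dom T -> 0 < 1 - T /\ 0 < 1 + T.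
Proof. by rewrite /time_dom /= => /andP[T1 T2]; split; lra. Qed.

Lemma time_change_diffeo : local_diffeo_at 0 time_change.
Proof.
have oJ := open_time_dom; have oT := @openT R.
pose D0 : set R := [set t | - (pi / 2) < t < pi / 2].
have oD0 : open D0 by exact: open_between.
have cD0 t : D0 t -> cos t != 0.
  by move=> t2; rewrite gt_eqF// cos_gt0_pihalf.
have stan : smooth_on D0 (@tan R) by exact: (smooth_tan oD0 cD0 (smooth_id _)).
pose D : set R := [set t | D0 t /\ 0 < 2 * m + tan t].
have oD : open D by apply: open_lt_smooth => //; smooth.
exists time_dom; first by rewrite /time_dom /=; lra.
apply: (@diffeo_of_inverse _ _ _ D _ time_change_inv) => //.
- rewrite /time_change; smooth => T /time_dom_bounds[T1 _]; exact: lt0r_neq0.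
- have sD : smooth_on D (@tan R) by apply: smooth_subset stan => t [].
  rewrite /time_change_inv; smooth => t [_]; exact: lt0r_neq0.
- move=> T /time_dom_bounds[T1 T2]; split.
    by rewrite /D0 /= atan_gtNpi2 atan_ltpi2.
  rewrite atanK (_ : _ + _ = 2 * m / (1 - T)); first by rewrite divr_gt0 ?mulr_gt0.
  by field; exact: lt0r_neq0.
- move=> T /time_dom_bounds[T1 T2]; rewrite /time_change_inv atanK.
  by field; rewrite (lt0r_neq0 T1)/= -mulrDr subrK mulr1 m2_neq0.
- move=> t [t1 t2]; rewrite /time_change (_ : _ / _ = tan t).
    by rewrite tanK// in_itv.
  by rewrite /time_change_inv; field; rewrite (lt0r_neq0 t2) addrK m2_neq0.
Qed.

(** * The radial transformations *)

(** The projective map fixing the origin that carries the parabola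
    [U = T - W ^ 2] to the ellipse traced by the wave on the axis
    [x = y = 0]. *)
Definition tau (T : R) (p : R * R) : R * R :=
  let rho := 2 * cos (time_change T) / (1 + T - p.1) in
  (rho * (m / (1 - T)) * p.1, rho * p.2).

Definition tau_inv (T : R) (p : R * R) : R * R :=
  let b := 1 + p.1 * ((1 - T) / (2 * m * cos (time_change T))) in
  ((1 + T) * (b - 1) / b, p.2 * (1 + T) / (2 * cos (time_change T) * b)).

Definition tau_dom : set (R * R) := [set p | p.1 < 2^-1].

Lemma open_tau_dom : open tau_dom.
Proof. by have oT := @openT (R * R)%type; apply: open_lt_smoothT; smooth. Qed.

Lemma cos_atan_gt0 (x : R) : 0 < cos (atan x).
Proof. by apply: cos_gt0_pihalf; rewrite atan_gtNpi2 atan_ltpi2. Qed.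

Lemma smooth_time_change : smooth_on time_dom time_change.
Proof.
have oJ := open_time_dom.
rewrite /time_change; smooth => T /time_dom_bounds[T1 _]; exact: lt0r_neq0.
Qed.

Lemma tau_den_gt0 T p : time_dom T -> tau_dom p -> 0 < 1 + T - p.1.
Proof. by rewrite /tau_dom /= => /andP[T1 T2] p1; lra. Qed.

Lemma smooth_tau : smooth_family_on time_dom tau_dom tau.
Proof.
have oJ := open_time_dom; have oA := open_tau_dom.
have oAJ : open (tau_dom `*` time_dom) by exact: open_setX.
have sc : smooth_on (tau_dom `*` time_dom) (fun q : (R * R) * R => time_change q.2).
  apply: (smooth_comp oAJ _ smooth_time_change); last by smooth.
  by move=> q [].
split=> //; rewrite /tau; smooth => q [q1 JT]; have [T1 T2] := time_dom_bounds JT;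
  by rewrite lt0r_neq0// tau_den_gt0.
Qed.

Lemma tau_diffeo T : time_dom T -> diffeo_on tau_dom (tau T).
Proof.
move=> JT; have [T1 T2] := time_dom_bounds JT.
have c0 : 0 < cos (time_change T) by exact: cos_atan_gt0.
have cn := lt0r_neq0 c0; have mn := lt0r_neq0 m0; have Tn := lt0r_neq0 T1.
have oA := open_tau_dom; have oT := @openT (R * R)%type.
pose D : set (R * R) := [set p |
   0 < 1 + p.1 * ((1 - T) / (2 * m * cos (time_change T)))].
have oD : open D by apply: open_lt_smoothT => //; smooth.
apply: (@diffeo_of_inverse _ _ _ D _ (tau_inv T)) => //.
- by rewrite /tau; smooth => p dp; rewrite lt0r_neq0// tau_den_gt0.
- rewrite /tau_inv; smooth => p p1; first exact: lt0r_neq0.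
  by rewrite mulf_neq0// ?mulf_neq0// lt0r_neq0.
- move=> p dp; have p1 := tau_den_gt0 JT dp; rewrite /D /tau /=.
  have pn := lt0r_neq0 p1.
  rewrite [ltRHS](_ : _ = (1 + T) / (1 + T - p.1)); first by rewrite divr_gt0.
  by field; rewrite cn mn Tn pn.
- move=> [u w] dp; have pn := lt0r_neq0 (tau_den_gt0 JT dp).
  have en : 1 + T - u + u != 0 by rewrite subrK lt0r_neq0.
  by rewrite /tau /tau_inv /=; congr pair; field; rewrite cn mn Tn pn en.
- move=> [u w] /= p1.
  have bn : 2 * m * cos (time_change T) + u * (1 - T) != 0.
    rewrite (_ : _ + _ = (1 + u * ((1 - T) / (2 * m * cos (time_change T))))
      * (2 * m * cos (time_change T))); last by field; rewrite cn mn.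
    by rewrite mulf_neq0// ?mulf_neq0 ?m2_neq0// lt0r_neq0.
  have en : (1 + T) * (2 * m * cos (time_change T) + u * (1 - T)) -
      (1 + T) * (2 * m * cos (time_change T) + u * (1 - T) +
       -1 * (2 * m * cos (time_change T))) != 0.
    rewrite (_ : _ - _ = (1 + T) * (2 * m * cos (time_change T))); last by ring.
    by rewrite !mulf_neq0// lt0r_neq0.
  by rewrite /tau /tau_inv /=; congr pair; field; rewrite cn mn bn ?Tn en.
Qed.

Lemma ray_through (u w : R) : (u, w) != 0 -> exists theta, ray theta (u, w).
Proof.
move=> uw0; have r20 : 0 < u ^+ 2 + w ^+ 2.
  rewrite lt0r addr_ge0 ?sqr_ge0// andbT paddr_eq0 ?sqr_ge0//.
  by apply: contra uw0; rewrite !sqrf_eq0 => /andP[/eqP-> /eqP->].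
pose r := Num.sqrt (u ^+ 2 + w ^+ 2).
have r0 : 0 < r by rewrite sqrtr_gt0.
have rn := lt0r_neq0 r0.
have r2 : r ^+ 2 = u ^+ 2 + w ^+ 2 by rewrite sqr_sqrtr// ltW.
pose c := u / r; pose s := w / r.
have cs1 : c ^+ 2 + s ^+ 2 = 1.
  by rewrite /c /s !expr_div_n -mulrDl -r2 divff// expf_neq0.
have c1 : -1 <= c <= 1.
  rewrite -ler_norml -(@ler_pXn2r _ 2)// ?nnegrE// real_normK ?num_real// expr1n.
  by rewrite -cs1 lerDl sqr_ge0.
have s2 : Num.sqrt (1 - c ^+ 2) = `|s|.
  by rewrite -cs1 addrAC subrr add0r sqrtr_sqr.
exists (if 0 <= s then acos c else - acos c); exists r => //.
have cc : cos (acos c) = c by rewrite acosK// in_itv.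
have ss : sin (acos c) = `|s| by rewrite sin_acos.
have [uE wE] : u = r * c /\ w = r * s.
  by rewrite /c /s; split; rewrite mulrC divfK.
rewrite {1}uE {1}wE; case: ifPn => s0; rewrite ?cosN ?sinN cc ss.
  by rewrite ger0_norm.
by rewrite ltr0_norm ?opprK// ltNge.
Qed.

(** Off the factor [2 cos t / (1 + T - U)], which is positive on the domain,
    [tau] is linear and diagonal. *)
Lemma tau_radial : local_radial_family tau.
Proof.
exists time_dom, tau_dom; split.
- by rewrite /time_dom /=; lra.
- by rewrite /tau_dom /=; lra.
- exact: smooth_tau.
move=> T JT; have [T1 T2] := time_dom_bounds JT; split.
- exact: tau_diffeo.
- by rewrite /tau /= !mulr0.
move=> theta; pose l := m / (1 - T); have l0 : 0 < l by rewrite divr_gt0.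
have c0 : 0 < cos (time_change T) by exact: cos_atan_gt0.
have [|theta' [r' r'0 [cE sE]]] := @ray_through (l * cos theta) (sin theta).
  apply/eqP => -[/eqP + s0]; rewrite mulf_eq0 (gt_eqF l0)/= => /eqP k0.
  by have := cos2Dsin2 theta; rewrite k0 s0 expr0n /= addr0 => /eqP; rewrite eq_sym oner_eq0.
exists theta' => _ [p [dp [r r0 pE]] <-]; rewrite {p}pE in dp *.
have d0 := tau_den_gt0 JT dp.
exists (2 * cos (time_change T) / (1 + T - r * cos theta) * r * r').
  by rewrite !mulr_gt0// invr_gt0.
rewrite /tau /= -/l; congr pair.
  by rewrite -[RHS]mulrA -cE /l; ring.
by rewrite -[RHS]mulrA -sE; ring.
Qed.

(** * The diffeomorphisms of space *)

Let space := (R * R * R)%type.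

Definition quad (p : space) : R := p.1.1 ^+ 2 + e * p.1.2 ^+ 2.
(** This is the denominator [1 + T - U] of [tau] along the bifurcation. *)
Definition den (p : space) : R := 1 + p.2 ^+ 2 - quad p.
Definition discr (p : space) : R := den p ^+ 2 - 4 * p.2 ^+ 2.
(** The ratio of [tan (z / 2)] to [Z]: the smaller root [r] of
    [Z ^ 2 r ^ 2 - den r + 1 = 0], written so as to be smooth at [Z = 0], where
    the equation degenerates. *)
Definition stretch (p : space) : R := 2 / (den p + Num.sqrt (discr p)).
Definition gain_den (p : space) : R := den p * (1 - p.2 ^+ 2 * stretch p).
(** The ratio of [a sin ^ 2 (x / 2) + e sin ^ 2 (y / 2)] to
    [X ^ 2 + e Y ^ 2]. *)
Definition gain (T : R) (p : space) : R := m * (1 + T) / ((1 - T) * gain_den p).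

Definition sigma (T : R) (p : space) : space :=
  (2 * asin (p.1.1 * Num.sqrt (gain T p / a)),
   2 * asin (p.1.2 * Num.sqrt (gain T p)),
   2 * atan (p.2 * stretch p)).

Definition sigma_predom : set space :=
  [set p | 0 < den p /\ 0 < discr p].

(** The two last inequalities ensure that both arcsines in [sigma] have an
    argument in the open interval of smoothness: [3 m] bounds
    [gain T p * gain_den p] for all [T] in [time_dom]. *)
Definition sigma_dom : set space :=
  [set p | (sigma_predom p /\ 3 * m * p.1.1 ^+ 2 < a * gain_den p) /\
    3 * m * p.1.2 ^+ 2 < gain_den p].

Lemma smooth_stretch (V : normedModType R) (A : set V) (f : V -> space) :
  open A -> (forall x, A x -> sigma_predom (f x)) -> smooth_on A f ->
  smooth_on A (fun x => stretch (f x)).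
Proof.
move=> oA Af sf; rewrite /stretch /discr /den /quad; smooth => x /Af[h0 d0] //.
by rewrite lt0r_neq0// addr_gt0// sqrtr_gt0.
Qed.

Lemma smooth_gain_den (V : normedModType R) (A : set V) (f : V -> space) :
  open A -> (forall x, A x -> sigma_predom (f x)) -> smooth_on A f ->
  smooth_on A (fun x => gain_den (f x)).
Proof.
move=> oA Af sf; have sr := smooth_stretch oA Af sf.
by rewrite /gain_den /den /quad; smooth.
Qed.

Lemma open_sigma_predom : open sigma_predom.
Proof.
have oT := @openT space.
have oden : open [set p | 0 < den p].
  by apply: open_lt_smoothT; rewrite /den /quad; smooth.
by apply: open_lt_smooth => //; rewrite /discr /den /quad; smooth.
Qed.

Lemma open_sigma_dom : open sigma_dom.
Proof.
have o0 := open_sigma_predom.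
have s0 := smooth_gain_den o0 (fun p dp => dp) (smooth_id _).
pose D := [set p | sigma_predom p /\ 3 * m * p.1.1 ^+ 2 < a * gain_den p].
have oD : open D by apply: open_lt_smooth => //; smooth.
have sD : smooth_on D gain_den by apply: smooth_subset s0 => p [].
by apply: (open_lt_smooth oD); smooth.
Qed.

(** The point of the construction is the last two equations, which say that
    [r], [q] and the squares of [xi] and [eta] solve the equation between the
    wave and the bifurcation. With [s] the square root of [discr p], one has
    [r = 2 / (den p + s)] and [q ^ 2 = (den p - s) / (den p + s)], from which
    they follow; the bound [q ^ 2 < 1] comes from [0 < s]. *)
Lemma sigma_dom_facts T p : time_dom T -> sigma_dom p ->
  let r := stretch p in let q := p.2 * r in
  let xi := p.1.1 * Num.sqrt (gain T p / a) in
  let eta := p.1.2 * Num.sqrt (gain T p) in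
  [/\ 0 < gain T p /\ 0 < r, -1 < xi < 1, -1 < eta < 1 &
    [/\ q ^+ 2 < 1, q ^+ 2 < r, r * den p = 1 + q ^+ 2 &
    a * xi ^+ 2 + e * eta ^+ 2 = (r - 1) * (m * (1 + T) / ((1 - T) * (1 + q ^+ 2)))]].
Proof.
move=> JT [[[h0 d0] xk] yk] r q xi eta.
have [T1 T2] := time_dom_bounds JT.
have sd0 : 0 < Num.sqrt (discr p) by rewrite sqrtr_gt0.
have den0 : 0 < den p + Num.sqrt (discr p) by rewrite addr_gt0.
have r0 : 0 < r by rewrite divr_gt0.
have k0 : 0 < gain_den p.
  by apply: le_lt_trans yk; apply: mulr_ge0 (sqr_ge0 _); rewrite mulr_ge0// ltW.
have w0 : 0 < 1 - p.2 ^+ 2 * r by move: k0; rewrite /gain_den pmulr_rgt0.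
have g0 : 0 < gain T p by rewrite divr_gt0 ?mulr_gt0.
have sE : Num.sqrt (discr p) ^+ 2 = discr p by rewrite sqr_sqrtr// ltW.
have q2E : q ^+ 2 = (den p - Num.sqrt (discr p)) / (den p + Num.sqrt (discr p)).
  have z2 : p.2 ^+ 2 = (den p ^+ 2 - Num.sqrt (discr p) ^+ 2) / 4.
    by rewrite sE /discr; field.
  by rewrite /q exprMn z2 /r /stretch; field; exact: lt0r_neq0.
have quadr : r * den p = 1 + q ^+ 2.
  by rewrite q2E /r /stretch; field; exact: lt0r_neq0.
have q2r : q ^+ 2 < r.
  rewrite /q exprMn expr2 mulrA -subr_gt0 (_ : _ - _ = r * (1 - p.2 ^+ 2 * r)).
    by rewrite mulr_gt0.
  by ring.
have q21 : q ^+ 2 < 1 by rewrite q2E ltr_pdivrMr// mul1r; lra.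
have T3 : (1 + T) / (1 - T) < 3.
  by rewrite ltr_pdivrMr//; move: JT => /andP[]; lra.
have gE : gain T p * gain_den p = m * ((1 + T) / (1 - T)).
  by rewrite /gain; field; rewrite !lt0r_neq0.
have ltg : gain T p * gain_den p < 3 * m by rewrite gE mulrC ltr_pM2r.
have norm1 (x : R) : x ^+ 2 < 1 -> -1 < x < 1.
  by rewrite -ltr_norml -real_normK ?num_real// expr_lt1.
have xg : Num.sqrt (gain T p / a) ^+ 2 = gain T p / a.
  by rewrite sqr_sqrtr// divr_ge0// ltW.
have yg : Num.sqrt (gain T p) ^+ 2 = gain T p by rewrite sqr_sqrtr// ltW.
split=> //.
- apply: norm1; rewrite exprMn xg.
  rewrite mulrA ltr_pdivrMr// mul1r -(@ltr_pM2r _ (gain_den p))//.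
  apply: le_lt_trans xk; rewrite -[leLHS]mulrA [leLHS]mulrC.
  by apply: ler_wpM2r; [exact: sqr_ge0|exact: ltW].
- apply: norm1; rewrite exprMn yg.
  rewrite -(@ltr_pM2r _ (gain_den p))// mul1r.
  apply: le_lt_trans yk; rewrite -[leLHS]mulrA [leLHS]mulrC.
  by apply: ler_wpM2r; [exact: sqr_ge0|exact: ltW].
split=> //.
rewrite -quadr /xi /eta !exprMn xg yg (_ : _ + _ = quad p * gain T p); last first.
  by rewrite /quad; field; rewrite lt0r_neq0.
have -> : quad p = (r - 1) * (1 - p.2 ^+ 2 * r) / r.
  apply: (mulIf (lt0r_neq0 r0)); rewrite divfK ?lt0r_neq0//.
  have -> : quad p = 1 + p.2 ^+ 2 - den p by rewrite /den; ring.
  rewrite mulrBl (mulrC (den p)) quadr /q; ring.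
rewrite /gain /gain_den -/r.
by field; rewrite !lt0r_neq0.
Qed.

Lemma cos_2asin (x : R) : -1 < x < 1 -> cos (2 * asin x) = 1 - 2 * x ^+ 2.
Proof.
move=> /andP[x1 x2]; rewrite mulr_natl cos_mulr2n -[in RHS](@asinK _ x).
  by rewrite cos2sin2; ring.
by rewrite in_itv /= !ltW.
Qed.

Lemma cos_sin_2atan (q : R) :
  cos (2 * atan q) = (1 - q ^+ 2) / (1 + q ^+ 2) /\
  sin (2 * atan q) = 2 * q / (1 + q ^+ 2).
Proof.
have c0 := lt0r_neq0 (cos_atan_gt0 q).
have q1 : 1 + q ^+ 2 != 0 by rewrite gt_eqF// ltr_pwDl// sqr_ge0.
have c2 : cos (atan q) ^+ 2 = (1 + q ^+ 2)^-1.
  by rewrite -{2}(atanK q) -cos2_tan2// invrK.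
have sE : sin (atan q) = q * cos (atan q).
  by rewrite -{2}(atanK q) /tan divfK.
rewrite mulr_natl cos_mulr2n sin_mulr2n sE.
rewrite (_ : cos _ * _ = q * cos (atan q) ^+ 2); last by ring.
by rewrite c2; split; field.
Qed.

Lemma smooth_sigma : smooth_family_on time_dom sigma_dom sigma.
Proof.
have oJ := open_time_dom; have oA := open_sigma_dom; have oAJ := open_setX oA oJ.
split=> //.
have sd0 (q : space * R) : (sigma_dom `*` time_dom) q -> sigma_predom q.1.
  by move=> [[[]]].
have s1 : smooth_on (sigma_dom `*` time_dom) (fun q : space * R => q.1) by smooth.
have sk := smooth_gain_den oAJ sd0 s1; have sr := smooth_stretch oAJ sd0 s1.
have k0 p T : time_dom T -> sigma_dom p -> 0 < gain_den p.
  move=> JT dp; have [[g0 _] _ _ _] := sigma_dom_facts JT dp.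
  have [T1 T2] := time_dom_bounds JT.
  have mT : 0 < m * (1 + T) by rewrite mulr_gt0.
  by move: g0; rewrite /gain (pmulr_rgt0 _ mT) invr_gt0 (pmulr_rgt0 _ T1).
have sg : smooth_on (sigma_dom `*` time_dom) (fun q : space * R => gain q.2 q.1).
  rewrite /gain; smooth => q [dp JT]; have [T1 T2] := time_dom_bounds JT.
  by rewrite lt0r_neq0// mulr_gt0// (k0 _ _ JT dp).
rewrite /sigma; smooth => q [dp JT];
  have [[g0 _] xi1 eta1 _] := sigma_dom_facts JT dp => //.
by rewrite divr_gt0.
Qed.

(** In terms of [q = tan (z / 2)] and [r = q / Z] the denominator
    [1 + T - U] is [(1 + q ^ 2) / r], and both components become rational
    identities. *)
Lemma wave_sigma T p : time_dom T -> sigma_dom p ->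
  wave a e (sigma T p, time_change T) = tau T (unfolding e (p, T)).
Proof.
move=> JT dp; have [T1 T2] := time_dom_bounds JT.
have [[g0 r0] xi1 eta1 [q1 qr rh xe]] := sigma_dom_facts JT dp.
rewrite /wave /sigma /tau /unfolding /= !cos_2asin//.
have [-> ->] := cos_sin_2atan (p.2 * stretch p).
have c0 := cos_atan_gt0 (2 * m * T / (1 - T)).
have sE : sin (time_change T) = 2 * m * T / (1 - T) * cos (time_change T).
  by rewrite -[X in X * _](atanK (2 * m * T / (1 - T))) /tan divfK// lt0r_neq0.
rewrite sE.
have -> : 1 + T - (p.1.1 ^+ 2 + e * p.1.2 ^+ 2 - p.2 ^+ 2 + T) = den p.
  by rewrite /den /quad; ring.
have -> : p.1.1 ^+ 2 + e * p.1.2 ^+ 2 - p.2 ^+ 2 + T = 1 + T - den p.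
  by rewrite /den /quad; ring.
set q := p.2 * stretch p in q1 qr rh xe *.
set xi := p.1.1 * _ in xi1 xe *; set eta := p.1.2 * _ in eta1 xe *.
have rn := lt0r_neq0 r0; have Tn := lt0r_neq0 T1.
have hE : den p = (1 + q ^+ 2) / stretch p by rewrite -rh mulrC mulKf.
have qn : 1 + q ^+ 2 != 0 by rewrite gt_eqF// ltr_pwDl// sqr_ge0.
have pE : p.2 = q / stretch p by rewrite /q mulfK.
rewrite hE; congr pair; last by rewrite pE; field; rewrite rn qn.
rewrite (_ : - _ - _ + _ = - m + 2 * (a * xi ^+ 2 + e * eta ^+ 2)
   + m * ((1 - q ^+ 2) / (1 + q ^+ 2))); last by rewrite /m; ring.
by rewrite xe; field; rewrite rn qn Tn.
Qed.

Definition half_tan (p : space) : R := tan (p.2 / 2).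

Definition coef (T : R) (p : space) : R :=
  (1 + half_tan p ^+ 2) * (1 - T) / (m * (1 + T)).

(** The value of [stretch] at the preimage, recovered from the image point. *)
Definition stretch_back (T : R) (p : space) : R :=
  1 + coef T p * (a * sin (p.1.1 / 2) ^+ 2 + e * sin (p.1.2 / 2) ^+ 2).

Definition sigma_inv (T : R) (p : space) : space :=
  let r := stretch_back T p in
  let w := coef T p * (r - half_tan p ^+ 2) in
  (sin (p.1.1 / 2) * Num.sqrt (a * w) / r,
   sin (p.1.2 / 2) * Num.sqrt w / r,
   half_tan p / r).

Definition half_box : set space :=
  ([set x | - pi < x < pi] `*` [set x | - pi < x < pi])
  `*` [set x | - (pi / 2) < x < pi / 2].

Definition sigma_cod (T : R) : set space :=
  [set p | half_box p /\ half_tan p ^+ 2 < stretch_back T p].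

Lemma asin_half (x : R) : -1 < x < 1 -> sin (2 * asin x / 2) = x.
Proof.
move=> /andP[x1 x2]; rewrite mulrAC divff// mul1r asinK//.
by rewrite in_itv /= !ltW.
Qed.

Lemma sqrt_cancel (x c r : R) : 0 < c -> 0 < r ->
  x * Num.sqrt c * Num.sqrt (r ^+ 2 / c) / r = x.
Proof.
move=> c0 r0; have rn := lt0r_neq0 r0; have cn := lt0r_neq0 c0.
rewrite -(mulrA x) -sqrtrM; last exact: ltW.
by rewrite [c * _]mulrC divfK// sqrtr_sqr gtr0_norm// mulfK.
Qed.

Lemma sqrt_cancel_r (x c r : R) : 0 < c -> 0 < r ->
  x * Num.sqrt c / r * Num.sqrt (r ^+ 2 / c) = x.
Proof. by move=> c0 r0; rewrite -[RHS](sqrt_cancel x c0 r0) mulrAC. Qed.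

Lemma sigma_back T p : time_dom T -> sigma_dom p ->
  half_tan (sigma T p) = p.2 * stretch p /\ stretch_back T (sigma T p) = stretch p.
Proof.
move=> JT dp; have [T1 T2] := time_dom_bounds JT.
have [[g0 r0] xi1 eta1 [q1 qr rh xe]] := sigma_dom_facts JT dp.
have qE : half_tan (sigma T p) = p.2 * stretch p.
  by rewrite /half_tan /sigma /= mulrAC divff// mul1r atanK.
split=> //; rewrite /stretch_back /coef qE /sigma /= !asin_half// xe.
set q := p.2 * stretch p.
have qn : 1 + q ^+ 2 != 0 by rewrite gt_eqF// ltr_pwDl// sqr_ge0.
by field; rewrite qn !lt0r_neq0.
Qed.

Lemma smooth_half_box T : time_dom T ->
  [/\ open half_box, smooth_on half_box half_tan, smooth_on half_box (coef T)
    & smooth_on half_box (stretch_back T)].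
Proof.
move=> JT; have [T1 T2] := time_dom_bounds JT.
have Sn := lt0r_neq0 T2; have mn := lt0r_neq0 m0; have pi0 := pi_gt0 R.
have obox : open half_box by do 2?apply: open_setX; exact: open_between.
have sq : smooth_on half_box half_tan.
  rewrite /half_tan; smooth => p [_ /= /andP[z1 z2]].
  by rewrite gt_eqF// cos_gt0_pihalf//; apply/andP; split; lra.
have sk : smooth_on half_box (coef T) by rewrite /coef; smooth.
by split=> //; rewrite /stretch_back; smooth.
Qed.

Lemma open_sigma_cod T : time_dom T -> open (sigma_cod T).
Proof.
by move=> /smooth_half_box[obox sq _ sr]; apply: open_lt_smooth => //; smooth.
Qed.

Lemma sigma_cod_facts T p : time_dom T -> sigma_cod T p ->
  [/\ 0 < coef T p, 0 < stretch_back T p,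
      0 < coef T p * (stretch_back T p - half_tan p ^+ 2) &
      half_tan p ^+ 2 < 1].
Proof.
move=> JT [[_ /= /andP[z1 z2]] qr]; have [T1 T2] := time_dom_bounds JT.
have pi0 := pi_gt0 R.
have k0 : 0 < coef T p.
  rewrite /coef divr_gt0//; last exact: mulr_gt0.
  by rewrite mulr_gt0// ltr_pwDl// sqr_ge0.
split=> //.
- by apply: le_lt_trans qr; exact: sqr_ge0.
- by apply: mulr_gt0; rewrite ?subr_gt0.
rewrite -real_normK ?num_real// expr_lt1// ltr_norml /half_tan.
have pz : p.2 / 2 \in `](- (pi / 2)), (pi / 2)[ by rewrite in_itv /=; lra.
have p4 : pi / 4 \in `](- (pi / 2)), (pi / 2 : R)[ by rewrite in_itv /=; lra.
have p4N : - (pi / 4) \in `](- (pi / 2)), (pi / 2 : R)[.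
  by rewrite in_itv /=; lra.
rewrite -[X in - X]tan_piquarter -[X in _ && (_ < X)]tan_piquarter -tanN.
by rewrite (ltr_tan p4N pz) (ltr_tan pz p4); lra.
Qed.

Lemma sigma_sub_cod T p : time_dom T -> sigma_dom p -> sigma_cod T (sigma T p).
Proof.
move=> JT dp; have [[g0 r0] xi1 eta1 [q1 qr _ _]] := sigma_dom_facts JT dp.
have [qE rE] := sigma_back JT dp.
have itv (x : R) : -1 < x < 1 -> - pi < 2 * asin x < pi.
  move=> /andP[x1 x2]; have := @asin_ltpi2 _ x; have := @asin_gtNpi2 _ x.
  rewrite x1 x2 !ltW// => /(_ isT) ? /(_ isT) ?; apply/andP; split; lra.
split; last by rewrite qE rE.
split; first by split=> /=; exact: itv.
have : -1 < p.2 * stretch p < 1.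
  by rewrite -ltr_norml -(@expr_lt1 _ 2)// real_normK ?num_real.
move=> /andP[/lt_atan + /lt_atan]; rewrite atanN atan1 /= => ? ?.
by apply/andP; split; lra.
Qed.

Lemma sigmaK T p : time_dom T -> sigma_dom p -> sigma_inv T (sigma T p) = p.
Proof.
move=> JT dp; have [T1 T2] := time_dom_bounds JT.
have [[g0 r0] xi1 eta1 [_ _ rh _]] := sigma_dom_facts JT dp.
have [qE rE] := sigma_back JT dp.
have gn := lt0r_neq0 g0; have rn := lt0r_neq0 r0; have an := lt0r_neq0 a0.
have Tn := lt0r_neq0 T1; have Sn := lt0r_neq0 T2; have mn := lt0r_neq0 m0.
have kw : coef T (sigma T p) * (stretch p - (p.2 * stretch p) ^+ 2) =
    stretch p ^+ 2 / gain T p.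
  have kn : gain_den p != 0.
    by apply: contraTneq g0 => k0; rewrite /gain k0 mulr0 invr0 mulr0 ltxx.
  rewrite /coef qE -rh /gain.
  rewrite (_ : stretch p - _ = stretch p * (1 - p.2 ^+ 2 * stretch p)); last by ring.
  rewrite (_ : _ * _ = stretch p ^+ 2 * gain_den p * (1 - T) / (m * (1 + T))).
    by field; rewrite Sn kn mn Tn.
  by rewrite /gain_den; field; rewrite Sn mn.
rewrite /sigma_inv qE rE kw /sigma /= !asin_half//.
rewrite (_ : a * _ = stretch p ^+ 2 / (gain T p / a)); last by field; rewrite an gn.
have ga0 : 0 < gain T p / a by exact: divr_gt0.
rewrite (sqrt_cancel _ ga0 r0) (sqrt_cancel _ g0 r0) mulfK//.
by rewrite -!surjective_pairing.
Qed.

(** At [sigma_inv T p] the discriminant is the square of [(1 - q ^ 2) / r],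
    where [q = half_tan p] and [r = stretch_back T p], so that [stretch]
    returns [r] there. *)
Lemma sigma_invK T p : time_dom T -> sigma_cod T p ->
  sigma T (sigma_inv T p) = p.
Proof.
move=> JT dp; have [T1 T2] := time_dom_bounds JT.
have [k0 r0 w0 q1] := sigma_cod_facts JT dp.
move: dp => [[[/= /andP[x1 x2] /andP[y1 y2]] /andP[z1 z2]] qr].
have an := lt0r_neq0 a0; have mn := lt0r_neq0 m0; have pi0 := pi_gt0 R.
have Tn := lt0r_neq0 T1; have Sn := lt0r_neq0 T2.
have kn := lt0r_neq0 k0; have rn := lt0r_neq0 r0.
have qn : 1 + half_tan p ^+ 2 != 0 by rewrite gt_eqF// ltr_pwDl// sqr_ge0.
have aw0 : 0 < a * (coef T p * (stretch_back T p - half_tan p ^+ 2)).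
  exact: mulr_gt0.
have wn : stretch_back T p - half_tan p ^+ 2 != 0.
  by rewrite lt0r_neq0// subr_gt0.
set p' := sigma_inv T p.
have quadE : quad p' = (stretch_back T p - 1)
    * (stretch_back T p - half_tan p ^+ 2) / stretch_back T p ^+ 2.
  have sE : a * sin (p.1.1 / 2) ^+ 2 + e * sin (p.1.2 / 2) ^+ 2 =
      (stretch_back T p - 1) / coef T p by rewrite /stretch_back; field.
  have sqE (x c : R) : 0 < c ->
      (x * Num.sqrt c / stretch_back T p) ^+ 2 = x ^+ 2 * c / stretch_back T p ^+ 2.
    by move=> c0; rewrite exprMn exprVn exprMn sqr_sqrtr// ltW.
  rewrite /quad /p' /sigma_inv /= !sqE//.
  transitivity ((a * sin (p.1.1 / 2) ^+ 2 + e * sin (p.1.2 / 2) ^+ 2) *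
      coef T p * (stretch_back T p - half_tan p ^+ 2) / stretch_back T p ^+ 2).
    by field.
  by rewrite sE; field; rewrite rn.
have hE : den p' = (1 + half_tan p ^+ 2) / stretch_back T p.
  by rewrite /den quadE /p' /sigma_inv /=; field.
have dE : discr p' = ((1 - half_tan p ^+ 2) / stretch_back T p) ^+ 2.
  by rewrite /discr hE /p' /sigma_inv /=; field.
have rE : stretch p' = stretch_back T p.
  rewrite /stretch dE sqrtr_sqr ger0_norm; last by rewrite divr_ge0 ?subr_ge0// ltW.
  by rewrite hE; field; rewrite rn; lra.
have gE : gain T p' = stretch_back T p ^+ 2
    / (coef T p * (stretch_back T p - half_tan p ^+ 2)).
  have -> : gain T p' = m * (1 + T) / ((1 - T) * ((1 + half_tan p ^+ 2)
      * (stretch_back T p - half_tan p ^+ 2) / stretch_back T p ^+ 2)).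
    rewrite /gain; congr (_ / (_ * _)).
    by rewrite /gain_den hE rE /p' /sigma_inv /=; field.
  by rewrite /coef; field; rewrite Sn mn qn Tn rn wn.
have gaE : gain T p' / a = stretch_back T p ^+ 2
    / (a * (coef T p * (stretch_back T p - half_tan p ^+ 2))).
  by rewrite gE; field; rewrite an kn wn.
have sinK2 (x : R) : - pi < x -> x < pi -> 2 * asin (sin (x / 2)) = x.
  move=> ? ?; rewrite sinK; first by rewrite mulrCA divff// mulr1.
  by rewrite in_itv /=; lra.
rewrite /sigma rE gaE gE /p' /sigma_inv /= !sqrt_cancel_r// divfK// !sinK2//.
rewrite /half_tan tanK; last by rewrite in_itv /=; lra.
by rewrite mulrCA divff// mulr1 -!surjective_pairing.
Qed.

Lemma sigma_diffeo T : time_dom T -> diffeo_on sigma_dom (sigma T).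
Proof.
move=> JT; have [_ sq sk sr] := smooth_half_box JT.
have oD := open_sigma_cod JT.
have box : sigma_cod T `<=` half_box by move=> p [].
have {}sq := smooth_subset box sq; have {}sk := smooth_subset box sk.
have {}sr := smooth_subset box sr.
apply: (@diffeo_of_inverse _ _ _ (sigma_cod T) _ (sigma_inv T)) => //.
- exact: open_sigma_dom.
- have [_ _ ss] := smooth_sigma.
  by move=> k; exact: Ck_slice JT (ss k).
- rewrite /sigma_inv; smooth => p /(sigma_cod_facts JT)[k0 r0 w0 _] //;
    try exact: lt0r_neq0.
  exact: mulr_gt0.
- by move=> p; exact: sigma_sub_cod.
- by move=> p; exact: sigmaK.
- by move=> p; exact: sigma_invK.
Qed.

Lemma sigma0 : sigma 0 0 = 0.
Proof.
have asin0 : asin (0 : R) = 0.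
  by rewrite -[X in asin X]sin0 sinK// in_itv /= oppr_le0 andbb divr_ge0// pi_ge0.
by rewrite /sigma /= !mul0r asin0 atan0 !mulr0.
Qed.

Lemma sigma_dom0 : sigma_dom 0.
Proof.
have hE : den 0 = 1 by rewrite /den /quad /= !expr0n /= mulr0 !addr0 subr0.
have dE : discr 0 = 1 by rewrite /discr hE /= expr0n /= mulr0 subr0 expr1n.
have kE : gain_den 0 = 1 by rewrite /gain_den hE /= expr0n /= mul0r subr0 mulr1.
by rewrite /sigma_dom /sigma_predom /= hE dE kE !expr0n /= !mulr0 mulr1.
Qed.

Lemma wave_equivalent Psi F : toR2 \o Psi = wave a e ->
  (forall q, toR2 (F q) = unfolding e q) -> radially_equivalent_families Psi F.
Proof.
move=> PsiE FE; exists time_change, sigma, tau.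
have J0 : time_dom (0 : R) by rewrite /time_dom /=; lra.
have dom0 := sigma_dom0.
split.
- split; first exact: time_change_diffeo.
  by rewrite /time_change mulr0 mul0r atan0.
- split; last exact: sigma0.
  exists time_dom, sigma_dom; split=> //; first exact: smooth_sigma.
  exact: sigma_diffeo.
- exact: tau_radial.
have : nbhs ((0 : space), (0 : R)) (sigma_dom `*` time_dom).
  apply: open_nbhs_nbhs; split=> //.
  by apply: open_setX; [exact: open_sigma_dom|exact: open_time_dom].
apply: filterS => -[p T] [/= dp JT].
rewrite FE -[LHS]/((toR2 \o Psi) (sigma T p, time_change T)) PsiE.
exact: wave_sigma.
Qed.

End Equivalence.

(** * The two singularities *)

Theorem proposition4p3 (R : realType) :
  (helmholtz_wave 1 1 (@Psi_DH R) /\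
   realizes (@Psi_DH R) (@definite_hyperbolic R) (@DH R)) /\
  (helmholtz_wave 1 1 (@Psi_I R) /\
   realizes (@Psi_I R) (@indefinite R) (@Ind R)).
Proof.
have DH0 : (0 : R) < 1 + 1 by lra.
have I0 : (0 : R) < 2 + -1 by lra.
split; split.
- exact: helmholtz_wave_of (@Psi_DHE R).
- split; last first.
    by apply: (wave_equivalent (a := 1) (e := 1)) => //; [exact: Psi_DHE|exact: DHE].
  by apply: (@nearW _ (nbhs (0 : R * R * R))) => -[[x y] z]; rewrite /DH addr0.
- exact: helmholtz_wave_of (@Psi_IE R).
- split; last first.
    by apply: (wave_equivalent (a := 2) (e := -1)) => //; [exact: Psi_IE|exact: IndE].
  by apply: (@nearW _ (nbhs (0 : R * R * R))) => -[[x y] z]; rewrite /Ind addr0.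
Qed.
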